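(* Let $\phi\to\psi$ be an INL-Sahlqvist formula, i.e. $\phi$ is an INL-Sahlqvist antecedent and $\psi$ is a positive INL formula. Then there is a two-sorted first-order formula $\alpha(x)$ of $\mathcal{L}_1$, containing none of the unary predicate symbols $P_1,P_2,\ldots$ and with at most the world variable $x$ free, such that for every neighbourhood frame $\mathbb{F}=(W,N)$ and every $w\in W$, $$\mathbb{F},w\Vdash\phi\to\psi\quad\text{iff}\quad\mathbb{F}^{2}\vDash\alpha(x)[w].$$
   Context: **INL formulas.** $\phi::=p\mid\bot\mid\top\mid\neg\phi\mid\phi_1\land\phi_2\mid\phi_1\lor\phi_2\mid\Box_n(\phi_1,\ldots,\phi_n;\phi)$, where $p$ ranges over a set $\mathsf{Prop}$ of propositional variables and $\Box_n$ is an $(n+1)$-ary modality for each $n\in\mathbb{N}$; $\phi\to\psi$ is defined in the standard way ($\neg\phi\lor\psi$). An occurrence of a propositional variable is positive (negative) if it is under the scope of an even (odd) number of negations. A formula is positive (negative) if all occurrences of propositional variables in it are positive (negative). A formula is pure if it contains no propositional variables. **Semantics.** A neighbourhood frame is $\mathbb{F}=(W,N)$ with $W\neq\varnothing$ and $N:W\to\mathcal{P}(\mathcal{P}(W))$. A valuation is a map $V:\mathsf{Prop}\to\mathcal{P}(W)$. Satisfaction $(\mathbb{F},V,w)\Vdash\phi$ is standard for variables and Booleans, and $(\mathbb{F},V,w)\Vdash\Box_n(\phi_1,\ldots,\phi_n;\phi)$ iff there is $S\in N(w)$ such that $(\mathbb{F},V,s)\Vdash\phi$ for all $s\in S$, and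 for each $i=1,\ldots,n$ there is $s_i\in S$ with $(\mathbb{F},V,s_i)\Vdash\phi_i$. $\mathbb{F},w\Vdash\phi$ means $(\mathbb{F},V,w)\Vdash\phi$ for all valuations $V$. **Abbreviations.** For $\theta$ pure, $\Delta_{n,\theta}(\phi_1,\ldots,\phi_n):=\Box_n(\phi_1,\ldots,\phi_n;\theta)$ and $\nabla_{1,\theta}(\phi_1):=\neg\Box_1(\neg\phi_1;\theta)$. **INL-Sahlqvist antecedents.** Pseudo-boxed atoms: $\zeta::=p\mid\bot\mid\top\mid\zeta\land\zeta\mid\nabla_{1,\theta}(\zeta)$, with $\theta$ pure. INL-Sahlqvist antecedents: $$\phi::=\zeta\mid\gamma\mid\bot\mid\top\mid\phi\land\phi\mid\phi\lor\phi\mid\Delta_{n,\theta}(\phi_1,\ldots,\phi_n)\mid\Box_n(\phi_1,\ldots,\phi_n;\zeta)\mid\Box_n(\phi_1,\ldots,\phi_n;\gamma),$$ where $n\in\mathbb{N}$, $\theta$ is pure, $\zeta$ is a pseudo-boxed atom, and $\gamma$ is a negative formula. **Two-sorted first-order language $\mathcal{L}_1$ (with equality).** It has world variables $x,y,z,\ldots$, subset variables $X,Y,Z,\ldots$ (both quantified as first-order variables of their sort), a binary relation symbol $R_{\ni}$ (subset sort, world sort), a binary relation symbol $R_N$ (world sort, subset sort), and unary predicate symbols $P_1,P_2,\ldots$ on the world sort. For $\mathbb{F}=(W,N)$, the two-sorted structure is $\mathbb{F}^2=(W,\mathcal{P}(W),R^{\ni},R^N)$ with world domain $W$ and subset domain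 $\mathcal{P}(W)$, where $R^{\ni}Xx$ iff $x\in X$, and $R^N xX$ iff $X\in N(x)$; these interpret $R_{\ni}$ and $R_N$. $\mathbb{F}^2\vDash\alpha(x)[w]$ means $\alpha$ is true in $\mathbb{F}^2$ when $x$ is assigned $w$. *)

(* Defs.v *)
From mathcomp Require Import all_boot.
From mathcomp Require Import classical_sets.

Set Implicit Arguments.
Unset Strict Implicit.
Unset Printing Implicit Defensive.

(** * INL formulas *)

(* [Box n f a] is the modality Box_n (f_1, ..., f_n; a). *)
Inductive form (PV : Type) : Type :=
| Var of PV
| Bot
| Top
| Neg of form PV
| And of form PV & form PV
| Or of form PV & form PV
| Box (n : nat) of ('I_n -> form PV) & form PV.

Arguments Bot {PV}.
Arguments Top {PV}.
Arguments Box {PV} n f a.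

Definition Imp (PV : Type) (a b : form PV) : form PV := Or (Neg a) b.

Definition Delta (PV : Type) (n : nat) (th : form PV) (f : 'I_n -> form PV) :
  form PV := Box n f th.

Definition Nabla1 (PV : Type) (th a : form PV) : form PV :=
  Neg (Box 1 (fun _ => Neg a) th).

(* [occurs a p k]: some occurrence of [p] in [a] is under the scope of exactly
   [k] negations. *)
Fixpoint occurs (PV : Type) (a : form PV) (p : PV) (k : nat) : Prop :=
  match a with
  | Var q => q = p /\ k = 0
  | Bot | Top => False
  | Neg b => exists2 j, k = j.+1 & occurs b p j
  | And b c | Or b c => occurs b p k \/ occurs c p k
  | Box _ f b => (exists i, occurs (f i) p k) \/ occurs b p k
  end.

Definition positive (PV : Type) (a : form PV) : Prop :=
  forall p k, occurs a p k -> ~~ odd k.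

Definition negative (PV : Type) (a : form PV) : Prop :=
  forall p k, occurs a p k -> odd k.

Definition pure (PV : Type) (a : form PV) : Prop :=
  forall p k, ~ occurs a p k.

Inductive pseudo_boxed (PV : Type) : form PV -> Prop :=
| pb_var p : pseudo_boxed (Var p)
| pb_bot : pseudo_boxed Bot
| pb_top : pseudo_boxed Top
| pb_and a b : pseudo_boxed a -> pseudo_boxed b -> pseudo_boxed (And a b)
| pb_nabla th a : pure th -> pseudo_boxed a -> pseudo_boxed (Nabla1 th a).

Inductive sahlqvist_antecedent (PV : Type) : form PV -> Prop :=
| sa_pseudo_boxed z : pseudo_boxed z -> sahlqvist_antecedent z
| sa_negative c : negative c -> sahlqvist_antecedent c
| sa_bot : sahlqvist_antecedent Bot
| sa_top : sahlqvist_antecedent Top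
| sa_and a b : sahlqvist_antecedent a -> sahlqvist_antecedent b ->
    sahlqvist_antecedent (And a b)
| sa_or a b : sahlqvist_antecedent a -> sahlqvist_antecedent b ->
    sahlqvist_antecedent (Or a b)
| sa_delta n th (f : 'I_n -> form PV) : pure th ->
    (forall i, sahlqvist_antecedent (f i)) -> sahlqvist_antecedent (Delta th f)
| sa_box_pseudo_boxed n (f : 'I_n -> form PV) z :
    (forall i, sahlqvist_antecedent (f i)) -> pseudo_boxed z ->
    sahlqvist_antecedent (Box n f z)
| sa_box_negative n (f : 'I_n -> form PV) c :
    (forall i, sahlqvist_antecedent (f i)) -> negative c ->
    sahlqvist_antecedent (Box n f c).

(** * Neighbourhood semantics *)

Record nframe : Type := NFrame {
  world :> Type;
  nbhd : world -> set (set world);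
  world_nonempty : ([set: world] !=set0)%classic
}.

Fixpoint sat (PV : Type) (F : nframe) (V : PV -> set F) (w : F) (a : form PV) :
  Prop :=
  match a with
  | Var p => V p w
  | Bot => False
  | Top => True
  | Neg b => ~ sat V w b
  | And b c => sat V w b /\ sat V w c
  | Or b c => sat V w b \/ sat V w c
  | Box n f b => exists S : set F,
      [/\ nbhd w S,
          forall s, S s -> sat V s b &
          forall i : 'I_n, exists2 s, S s & sat V s (f i)]
  end.

Definition valid_at (PV : Type) (F : nframe) (w : F) (a : form PV) : Prop :=
  forall V : PV -> set F, sat V w a.

(** * The two-sorted first-order language L1 *)

(* World variables, subset variables and the unary predicate symbols are each
   indexed by [nat]; the two sorts of variables are kept apart by the
   constructor in which the index occurs. *)
Inductive L1 : Type :=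
| LEqW (x y : nat)
| LEqS (X Y : nat)
| LRni (X x : nat)
| LRN (x X : nat)
| LPred (i x : nat)
| LBot
| LTop
| LNeg (a : L1)
| LAnd (a b : L1)
| LOr (a b : L1)
| LImp (a b : L1)
| LAllW (x : nat) (a : L1)
| LExW (x : nat) (a : L1)
| LAllS (X : nat) (a : L1)
| LExS (X : nat) (a : L1).

Fixpoint fvW (a : L1) : seq nat :=
  match a with
  | LEqW x y => [:: x; y]
  | LEqS _ _ | LBot | LTop => [::]
  | LRni _ x | LRN x _ | LPred _ x => [:: x]
  | LNeg b | LAllS _ b | LExS _ b => fvW b
  | LAnd b c | LOr b c | LImp b c => fvW b ++ fvW c
  | LAllW x b | LExW x b => [seq y <- fvW b | y != x]
  end.

Fixpoint fvS (a : L1) : seq nat :=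
  match a with
  | LEqS X Y => [:: X; Y]
  | LEqW _ _ | LPred _ _ | LBot | LTop => [::]
  | LRni X _ | LRN _ X => [:: X]
  | LNeg b | LAllW _ b | LExW _ b => fvS b
  | LAnd b c | LOr b c | LImp b c => fvS b ++ fvS c
  | LAllS X b | LExS X b => [seq Y <- fvS b | Y != X]
  end.

Fixpoint pred_free (a : L1) : bool :=
  match a with
  | LPred _ _ => false
  | LEqW _ _ | LEqS _ _ | LRni _ _ | LRN _ _ | LBot | LTop => true
  | LNeg b | LAllW _ b | LExW _ b | LAllS _ b | LExS _ b => pred_free b
  | LAnd b c | LOr b c | LImp b c => pred_free b && pred_free c
  end.

Record L1_structure : Type := L1Structure {
  wdom : Type;
  sdom : Type;
  Rni : sdom -> wdom -> Prop;
  RN : wdom -> sdom -> Prop;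
  Pred : nat -> wdom -> Prop
}.

Definition upd (T : Type) (g : nat -> T) (x : nat) (t : T) : nat -> T :=
  fun y => if y == x then t else g y.

Fixpoint L1_sat (M : L1_structure) (g : nat -> wdom M) (G : nat -> sdom M)
  (a : L1) : Prop :=
  match a with
  | LEqW x y => g x = g y
  | LEqS X Y => G X = G Y
  | LRni X x => Rni (G X) (g x)
  | LRN x X => RN (g x) (G X)
  | LPred i x => Pred i (g x)
  | LBot => False
  | LTop => True
  | LNeg b => ~ L1_sat g G b
  | LAnd b c => L1_sat g G b /\ L1_sat g G c
  | LOr b c => L1_sat g G b \/ L1_sat g G c
  | LImp b c => L1_sat g G b -> L1_sat g G c
  | LAllW x b => forall t : wdom M, L1_sat (upd g x t) G b
  | LExW x b => exists t : wdom M, L1_sat (upd g x t) G b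
  | LAllS X b => forall T : sdom M, L1_sat g (upd G X T) b
  | LExS X b => exists T : sdom M, L1_sat g (upd G X T) b
  end.

(* The structure F^2 interprets only R_ni and R_N; [frame2 F I] is its expansion
   interpreting the unary predicate symbols by [I], which is immaterial to the
   truth of [pred_free] formulas. *)
Definition frame2 (F : nframe) (I : nat -> set F) : L1_structure :=
  {| wdom := F;
     sdom := set F;
     Rni := fun X x => X x;
     RN := fun x X => nbhd x X;
     Pred := I |}.

(* Main.v *)
Require Import Defs.
From mathcomp Require Import all_boot.
From mathcomp Require Import boolp classical_sets.

Set Implicit Arguments.
Unset Strict Implicit.
Unset Printing Implicit Defensive.

(** A valuation V makes a Sahlqvist antecedent true at w exactly when, for one of
    finitely many choices at the disjunctions, there are witnessing worlds and
    neighbourhoods that satisfy a first-order condition, V lies above a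
    first-order definable valuation M built from the witnesses (the contribution
    of the pseudo-boxed atoms), and V satisfies some negative formulas at the
    witnesses or throughout the witnessing neighbourhoods.  So phi -> psi is valid
    at w iff, for each choice and all witnesses satisfying the condition, every V
    above M satisfies K, where K is the disjunction of psi and of the negations of
    the negative conditions.  Since K is preserved by enlarging V, this holds iff
    K holds at M itself, and the quantifier over valuations has disappeared: K at
    M is a first-order condition because M is definable.

    No normal form is computed.  Instead, [eliminable R] says that the
    quantifier over valuations can be removed from

      for all V above M, R or K

    whatever the definable valuation M and the upward closed K.  The false
    condition is eliminable (evaluate K at M), and if R is eliminable then so is
    'A implies R' for several kinds of A: a lower bound on V enlarges M
    ([eliminable_imp_lower]), the negation of an upward closed condition joins K
    ([eliminable_imp_downward]), and an existential witness turns into a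
    universal first-order quantifier in front ([eliminable_allW],
    [eliminable_allS]).  Hence prefixing a Sahlqvist antecedent to an eliminable
    condition keeps it eliminable ([absorbable_sahlqvist]); for R false, M empty
    and K = psi this is the theorem.

    Formulas of the two-sorted language are never manipulated beyond
    [definable], which asserts that some formula without predicate symbols
    expresses a given condition.  The stray variables of such a formula are
    removed at the end: if the condition depends on x only, the other free
    variables may be quantified universally ([definable_by_one_variable]). *)

(** * Definable predicates of an environment *)

Definition env (F : nframe) : Type := ((nat -> F) * (nat -> set F))%type.

Definition updW (F : nframe) (e : env F) (z : nat) (t : F) : env F :=
  (upd e.1 z t, e.2).

Definition updS (F : nframe) (e : env F) (Z : nat) (T : set F) : env F :=
  (e.1, upd e.2 Z T).

Definition definable (P : forall F : nframe, env F -> Prop) : Prop :=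
  exists2 a : L1, pred_free a &
    forall (F : nframe) (I : nat -> set F) (e : env F),
      L1_sat (M := frame2 I) e.1 e.2 a <-> P F e.

(** All but finitely many variables are irrelevant to [A].  Asking this of the
    semantic object, rather than reading free variables off a formula, makes it
    meaningful for objects that no formula defines, such as a condition on a
    valuation, while still providing variables that are safe to quantify. *)
Definition fresh (T : nframe -> Type) (A : forall F, env F -> T F) : Prop :=
  exists k0, forall k, k0 <= k -> forall F (e : env F),
    (forall t, A F (updW e k t) = A F e) /\
    (forall S, A F (updS e k S) = A F e).

Lemma fresh_const (T : nframe -> Type) (c : forall F : nframe, T F) :
  fresh (fun F _ => c F).
Proof. by exists 0. Qed.

Lemma fresh_varW x : fresh (fun (F : nframe) (e : env F) => e.1 x).
Proof.
exists x.+1 => k lt_xk F e; split=> // t.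
by rewrite /= /upd ltn_eqF.
Qed.

Lemma fresh_varS X : fresh (fun (F : nframe) (e : env F) => e.2 X).
Proof.
exists X.+1 => k lt_Xk F e; split=> // S.
by rewrite /= /upd ltn_eqF.
Qed.

Lemma fresh_pair (T U : nframe -> Type)
    (A : forall F, env F -> T F) (B : forall F, env F -> U F) :
  fresh A -> fresh B -> fresh (T := fun F => (T F * U F)%type)
    (fun F e => (A F e, B F e)).
Proof.
move=> [ka hA] [kb hB]; exists (maxn ka kb) => k.
rewrite geq_max => /andP[/hA {}hA /hB {}hB] F e.
have [[hA1 hA2] [hB1 hB2]] := (hA F e, hB F e).
by split=> t; rewrite ?hA1 ?hB1 ?hA2 ?hB2.
Qed.

(** Freshness passes from [A] to whatever is computed from [A]; with
    [fresh_pair], this settles freshness of any expression from that of its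
    ingredients. *)
Lemma fresh_factor (T U : nframe -> Type)
    (A : forall F, env F -> T F) (B : forall F, env F -> U F) :
  fresh A -> (forall F e e', A F e = A F e' -> B F e = B F e') -> fresh B.
Proof.
move=> [k0 hA] AB; exists k0 => k /hA {}hA F e.
by split=> t; apply: AB; apply (hA F e).
Qed.

Section Connectives.
Implicit Types P Q : forall F : nframe, env F -> Prop.

Lemma definable_ext P Q :
  definable P -> (forall F e, P F e <-> Q F e) -> definable Q.
Proof.
move=> [a pa ha] PQ; exists a => // F I e.
by apply: (iff_trans (ha F I e)); apply: PQ.
Qed.

Lemma definable_const (c : Prop) : definable (fun F _ => c).
Proof.
have [hc|hc] := pselect c; first by exists LTop.
by exists LBot.
Qed.

Lemma definable_not P : definable P -> definable (fun F e => ~ P F e).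
Proof.
move=> [a pa ha]; exists (LNeg a) => // F I e /=.
by have := ha F I e; tauto.
Qed.

Lemma definable_and P Q :
  definable P -> definable Q -> definable (fun F e => P F e /\ Q F e).
Proof.
move=> [a pa ha] [b pb hb]; exists (LAnd a b) => [/=|F I e /=].
  by rewrite pa.
by have := (ha F I e, hb F I e); case; tauto.
Qed.

Lemma definable_or P Q :
  definable P -> definable Q -> definable (fun F e => P F e \/ Q F e).
Proof.
move=> [a pa ha] [b pb hb]; exists (LOr a b) => [/=|F I e /=].
  by rewrite pa.
by have := (ha F I e, hb F I e); case; tauto.
Qed.

Lemma definable_imp P Q :
  definable P -> definable Q -> definable (fun F e => P F e -> Q F e).
Proof.
move=> [a pa ha] [b pb hb]; exists (LImp a b) => [/=|F I e /=].
  by rewrite pa.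
by have := (ha F I e, hb F I e); case; tauto.
Qed.

End Connectives.

(** The bound variable is chosen only here, among those irrelevant to [Q], which
    is why the body must be definable for every choice of [z]. *)
Lemma definable_allW (Q : forall F, env F -> F -> Prop) :
  fresh Q -> (forall z, definable (fun F e => Q F e (e.1 z))) ->
  definable (fun F e => forall t, Q F e t).
Proof.
move=> [z hz] hQ; have [a pa ha] := hQ z; exists (LAllW z a) => // F I e /=.
have hup t : L1_sat (M := frame2 I) (upd e.1 z t) e.2 a <-> Q F e t.
  apply: (iff_trans (ha F I (updW e z t))).
  by rewrite (hz z (leqnn z) F e).1 /= /upd eqxx.
by split=> h t; have := h t; rewrite hup.
Qed.

Lemma definable_allS (Q : forall F, env F -> set F -> Prop) :
  fresh Q -> (forall Z, definable (fun F e => Q F e (e.2 Z))) ->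
  definable (fun F e => forall T, Q F e T).
Proof.
move=> [z hz] hQ; have [a pa ha] := hQ z; exists (LAllS z a) => // F I e /=.
have hup t : L1_sat (M := frame2 I) e.1 (upd e.2 z t) a <-> Q F e t.
  apply: (iff_trans (ha F I (updS e z t))).
  by rewrite (hz z (leqnn z) F e).2 /= /upd eqxx.
by split=> h t; have := h t; rewrite hup.
Qed.

Lemma definable_exW (Q : forall F, env F -> F -> Prop) :
  fresh Q -> (forall z, definable (fun F e => Q F e (e.1 z))) ->
  definable (fun F e => exists t, Q F e t).
Proof.
move=> frQ hQ.
pose nQ F e t := ~ Q F e t.
apply: definable_ext (definable_not (definable_allW (Q := nQ) _ _)) _.
- by apply: (fresh_factor frQ) => F e e'; rewrite /nQ => ->.
- by move=> z; apply: definable_not.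
- by move=> F e; rewrite forallNE notK.
Qed.

Lemma definable_exS (Q : forall F, env F -> set F -> Prop) :
  fresh Q -> (forall Z, definable (fun F e => Q F e (e.2 Z))) ->
  definable (fun F e => exists T, Q F e T).
Proof.
move=> frQ hQ.
pose nQ F e t := ~ Q F e t.
apply: definable_ext (definable_not (definable_allS (Q := nQ) _ _)) _.
- by apply: (fresh_factor frQ) => F e e'; rewrite /nQ => ->.
- by move=> z; apply: definable_not.
- by move=> F e; rewrite forallNE notK.
Qed.

Lemma definable_all_ord n (P : 'I_n -> forall F : nframe, env F -> Prop) :
  (forall i, definable (P i)) -> definable (fun F e => forall i, P i F e).
Proof.
move=> hP.
have hs (s : seq 'I_n) : definable (fun F e => forall i, i \in s -> P i F e).
  elim: s => [|j s IHs].
    by apply: definable_ext (definable_const True) _.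
  apply: definable_ext (definable_and (hP j) IHs) _ => F e; split.
    by move=> [hj hs] i; rewrite inE => /orP[/eqP->|/hs].
  move=> h; split=> [|i si]; first by apply: h; rewrite mem_head.
  by apply: h; rewrite inE si orbT.
apply: definable_ext (hs (enum 'I_n)) _ => F e.
by split=> h i => [|_]; apply: h; rewrite mem_enum.
Qed.

Lemma definable_mem X x : definable (fun F e => e.2 X (e.1 x)).
Proof. by exists (LRni X x). Qed.

Lemma definable_nbhd x X : definable (fun F e => nbhd (e.1 x) (e.2 X)).
Proof. by exists (LRN x X). Qed.

Lemma definable_eqW x y : definable (fun F e => e.1 x = e.1 y).
Proof. by exists (LEqW x y). Qed.

Lemma definable_allin X (Q : forall F, env F -> F -> Prop) :
  fresh Q -> (forall z, definable (fun F e => Q F e (e.1 z))) ->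
  definable (fun F e => forall t, e.2 X t -> Q F e t).
Proof.
move=> frQ hQ; apply: definable_allW => [|z].
  by apply: (fresh_factor (fresh_pair (fresh_varS X) frQ)) => F e e' [-> ->].
exact: definable_imp (definable_mem X z) (hQ z).
Qed.

Lemma definable_exin X (Q : forall F, env F -> F -> Prop) :
  fresh Q -> (forall z, definable (fun F e => Q F e (e.1 z))) ->
  definable (fun F e => exists2 t, e.2 X t & Q F e t).
Proof.
move=> frQ hQ.
apply: (@definable_ext (fun F e => exists t, e.2 X t /\ Q F e t)); last first.
  by move=> F e; split=> [[t []]|[t]]; exists t.
apply: definable_exW => [|z].
  by apply: (fresh_factor (fresh_pair (fresh_varS X) frQ)) => F e e' [-> ->].
exact: definable_and (definable_mem X z) (hQ z).
Qed.

(** * Valuations *)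

Section Sahlqvist.
Variable PV : Type.
Implicit Types (a b : form PV) (p q : PV).

Definition vle (F : nframe) (V V' : PV -> set F) : Prop :=
  forall p t, V p t -> V' p t.

(** Positive, negative and pure formulas at once: only the valuations of the
    variables with an even occurrence have to grow, and only those with an odd
    occurrence have to shrink. *)
Lemma sat_polarity (F : nframe) a (V V' : PV -> set F) w :
  (forall p k, occurs a p k -> forall t,
     if odd k then V' p t -> V p t else V p t -> V' p t) ->
  sat V w a -> sat V' w a.
Proof.
elim: a V V' w
    => [p|||b IHb|b IHb c IHc|b IHb c IHc|n f IHf b IHb] V V' w //= hV.
- exact: (hV p 0 (conj erefl erefl) w).
- move=> hb hb'; apply: hb; move: hb'; apply: IHb => p k hk t.
  by have := hV p k.+1 (ex_intro2 _ _ k erefl hk) t; rewrite /=; case: odd.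
- move=> [hb hc]; split; [move: hb; apply: IHb | move: hc; apply: IHc];
    by move=> p k hk; apply: hV; tauto.
- move=> [hb|hc]; [left; move: hb; apply: IHb | right; move: hc; apply: IHc];
    by move=> p k hk; apply: hV; tauto.
- move=> [S [wS hb hf]]; exists S; split=> // [s /hb|i].
    by apply: IHb => p k hk; apply: hV; right.
  have [s Ss hs] := hf i; exists s => //; move: hs.
  by apply: IHf => p k hk; apply: hV; left; exists i.
Qed.

Lemma sat_positive (F : nframe) a (V V' : PV -> set F) w :
  positive a -> vle V V' -> sat V w a -> sat V' w a.
Proof.
move=> pos VV'; apply: sat_polarity => p k /pos ev t.
by rewrite (negbTE ev); apply: VV'.
Qed.

Lemma sat_negative (F : nframe) a (V V' : PV -> set F) w :
  negative a -> vle V V' -> sat V' w a -> sat V w a.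
Proof.
move=> neg VV'; apply: sat_polarity => p k /neg odd_k t.
by rewrite odd_k; apply: VV'.
Qed.

Lemma sat_pure (F : nframe) a (V V' : PV -> set F) w :
  pure a -> sat V w a <-> sat V' w a.
Proof. by move=> pur; split; apply: sat_polarity => p k /pur. Qed.

Lemma pure_negative a : pure a -> negative a.
Proof. by move=> pur p k /pur. Qed.

Definition definable_val (M : forall F, env F -> PV -> set F) : Prop :=
  fresh M /\ forall p y, definable (fun F e => M F e p (e.1 y)).

Definition val0 (F : nframe) : PV -> set F := fun _ _ => False.

Lemma definable_val0 : definable_val (fun F _ => val0 (F := F)).
Proof. by split=> [|p y]; [apply: fresh_const | apply: definable_const]. Qed.

Lemma definable_valU M M' : definable_val M -> definable_val M' ->
  definable_val (fun F e p t => M F e p t \/ M' F e p t).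
Proof.
move=> [fM hM] [fM' hM']; split=> [|p y]; last exact: definable_or.
by apply: (fresh_factor (fresh_pair fM fM')) => F e e' [-> ->].
Qed.

(** The standard translation, with the predicate symbols replaced by formulas
    defining the valuation. *)
Lemma definable_sat M a x :
  definable_val M -> definable (fun F e => sat (M F e) (e.1 x) a).
Proof.
move=> [fM hM]; elim: a x
    => [p|||b IHb|b IHb c IHc|b IHb c IHc|n f IHf b IHb] x /=.
- exact: hM.
- exact: definable_const.
- exact: definable_const.
- exact: definable_not.
- exact: definable_and.
- exact: definable_or.
have fMs c : fresh (fun F e t => sat (M F e) t c).
  by apply: (fresh_factor fM) => F e e' ->.
apply: definable_exS => [|Z].
  by apply: (fresh_factor (fresh_pair (fresh_varW x) fM)) => F e e' [-> ->].
apply: (@definable_ext (fun F e => nbhd (e.1 x) (e.2 Z) /\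
    ((forall s, e.2 Z s -> sat (M F e) s b) /\
     forall i, exists2 s, e.2 Z s & sat (M F e) s (f i)))).
  apply: definable_and (definable_nbhd x Z) (definable_and _ _).
    by apply: definable_allin.
  by apply: definable_all_ord => i; apply: definable_exin.
by move=> F e; split=> [[? []]|[]].
Qed.

(** * Pseudo-boxed atoms *)

(** A pseudo-boxed atom is a conjunction of first-order conditions and of
    conditions that put definable sets of worlds into the valuation, because
    [Nabla1 th a] asserts [a] throughout every neighbourhood included in [th].
    The condition [C] is there for the occurrences of [Bot]. *)
Lemma pseudo_boxed_lower (z : form PV) : pseudo_boxed z ->
  exists (C : forall F : nframe, F -> Prop)
         (m : forall F : nframe, F -> PV -> set F),
    [/\ forall (F : nframe) (V : PV -> set F) w,
          sat V w z <-> C F w /\ vle (m F w) V,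
        forall x, definable (fun F e => C F (e.1 x)) &
        forall p x y, definable (fun F e => m F (e.1 x) p (e.1 y))].
Proof.
elim=> {z} [p|||a b _ [Ca [ma [ha dCa dma]]] _ [Cb [mb [hb dCb dmb]]]
           |th a pth _ [C [m [hm dC dm]]]].
- exists (fun _ _ => True), (fun F w q t => q = p /\ t = w); split.
  + by move=> F V w; split=> [Vpw|[_]]; [split=> // q t [-> ->] | apply].
  + by move=> x; apply: definable_const.
  + move=> q x y; exact: definable_and (definable_const _) (definable_eqW y x).
- exists (fun _ _ => False), (fun F _ => val0 (F := F)); split.
  + by move=> F V w; split=> // -[].
  + by move=> x; apply: definable_const.
  + by move=> p x y; apply: definable_const.
- exists (fun _ _ => True), (fun F _ => val0 (F := F)); split.
  + by move=> F V w; split=> // _; split.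
  + by move=> x; apply: definable_const.
  + by move=> p x y; apply: definable_const.
- exists (fun F w => Ca F w /\ Cb F w),
         (fun F w p t => ma F w p t \/ mb F w p t); split.
  + move=> F V w /=; rewrite ha hb; split.
      move=> [[? Va] [? Vb]]; do 2?split=> //.
      by move=> p t [/Va|/Vb].
    by move=> [[Caw Cbw] Vab]; split; split=> // p t mt; apply: Vab;
      [left | right].
  + by move=> x; apply: definable_and.
  + by move=> p x y; apply: definable_or.
(* A pure formula has the same truth value at all valuations, so the empty one
   can stand for the valuation of the context. *)
pose box F w S := nbhd w S /\ forall s, S s -> sat (val0 (F := F)) s th.
have dbox x Z : definable (fun F e => box F (e.1 x) (e.2 Z)).
  apply: definable_and (definable_nbhd x Z) _.
  apply: definable_allin => [|s]; first exact: fresh_const.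
  exact: definable_sat definable_val0.
exists (fun F w => forall S, box F w S -> forall s, S s -> C F s),
       (fun F w p t =>
          exists S, box F w S /\ exists2 s, S s & m F s p t); split.
- move=> F V w; split.
    move=> nab.
    have aS S s : box F w S -> S s -> sat V s a.
      move=> [wS thS] Ss; apply: contrapT => nas; apply: nab; exists S.
      split=> // [u /thS|_]; last by exists s.
      by apply: (proj1 (sat_pure _ _ _ pth)).
    split=> [S bS s Ss|p t [S [bS [s Ss]]]]; have := aS S s bS Ss;
      by rewrite hm => -[? Vm] //; apply: Vm.
  move=> [hC hV] [S [wS thS /(_ ord0)[s Ss]]].
  have bS : box F w S.
    by split=> // u /thS; apply: (proj1 (sat_pure _ _ _ pth)).
  apply=> /=; apply/hm; split; first exact: hC Ss.
  by move=> p t mt; apply: hV; exists S; split=> //; exists s.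
- move=> x; apply: definable_allS => [|Z].
    by apply: (fresh_factor (fresh_varW x)) => F e e' ->.
  apply: definable_imp (dbox x Z) _.
  by apply: definable_allin => //; apply: fresh_const.
- move=> p x y; apply: definable_exS => [|Z].
    apply: (fresh_factor (fresh_pair (fresh_varW x) (fresh_varW y))).
    by move=> F e e' [-> ->].
  apply: definable_and (dbox x Z) _.
  apply: definable_exin => [|s]; last exact: dm.
  by apply: (fresh_factor (fresh_varW y)) => F e e' ->.
Qed.

(** * Eliminating the quantifier over valuations *)

(** Besides being closed upwards, [K] must become first-order at every definable
    valuation, as it is going to be evaluated at a minimal one. *)
Definition upward (K : forall F, env F -> (PV -> set F) -> Prop) : Prop :=
  [/\ fresh K,
      forall F e V V', vle V V' -> K F e V -> K F e V' &
      forall M, definable_val M -> definable (fun F e => K F e (M F e))].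

Lemma upward_or K K' : upward K -> upward K' ->
  upward (fun F e V => K F e V \/ K' F e V).
Proof.
move=> [fK uK dK] [fK' uK' dK']; split.
- by apply: (fresh_factor (fresh_pair fK fK')) => F e e' [-> ->].
- by move=> F e V V' VV' [/(uK _ _ _ _ VV')|/(uK' _ _ _ _ VV')]; tauto.
- by move=> M dM; apply: definable_or; [apply: dK | apply: dK'].
Qed.

Lemma upward_positive a x : positive a -> upward (fun F e V => sat V (e.1 x) a).
Proof.
move=> pos; split.
- by apply: (fresh_factor (fresh_varW x)) => F e e' ->.
- by move=> F e V V'; apply: sat_positive.
- by move=> M; apply: definable_sat.
Qed.

(** [M] and [K] are universally quantified because they accumulate, while an
    antecedent is traversed, the lower bounds on [V] and the negative conditions
    met so far. *)
Definition eliminable (R : forall F, env F -> (PV -> set F) -> Prop) : Prop :=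
  fresh R /\ forall M K, definable_val M -> upward K ->
    definable (fun F e => forall V, vle (M F e) V -> R F e V \/ K F e V).

Implicit Types R A : forall F : nframe, env F -> (PV -> set F) -> Prop.

Lemma eliminable_ext R R' :
  eliminable R -> (forall F e V, R F e V <-> R' F e V) -> eliminable R'.
Proof.
move=> eR RR'; suff <- : R = R' by [].
by do 3!apply: functional_extensionality_dep => ?; apply/propext/RR'.
Qed.

(** The minimal valuation argument: an upward closed condition holds at all
    valuations above [M] as soon as it holds at [M]. *)
Lemma eliminable_false : eliminable (fun _ _ _ => False).
Proof.
split=> [|M K dM [_ uK dK]]; first exact: fresh_const.
apply: definable_ext (dK M dM) _ => F e; split.
  by move=> KM V /uK; right; auto.
by move=> /(_ (M F e)) []// p.
Qed.

(** The negation of [A] is absorbed by the upward closed disjunct. *)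
Lemma eliminable_imp_downward A R :
  upward (fun F e V => ~ A F e V) ->
  eliminable R -> eliminable (fun F e V => A F e V -> R F e V).
Proof.
move=> uA [fR dR]; have [fA _ _] := uA; split.
  apply: (fresh_factor (fresh_pair fA fR)) => F e e' [nA ->].
  apply: functional_extensionality_dep => V.
  by have := congr1 (fun B => ~ B V) nA; rewrite /= !notK => ->.
move=> M K dM uK.
apply: definable_ext (dR M _ dM (upward_or uA uK)) _ => F e.
split=> h V MV; have := h V MV; have := pselect (A F e V); tauto.
Qed.

(** The valuations above [M] that satisfy [A] are those above the union of [M]
    and [m], provided that [C] holds. *)
Lemma eliminable_imp_lower A R
    (C : forall F, env F -> Prop) (m : forall F, env F -> PV -> set F) :
  (forall F e V, A F e V <-> C F e /\ vle (m F e) V) ->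
  fresh C -> definable C -> definable_val m ->
  eliminable R -> eliminable (fun F e V => A F e V -> R F e V).
Proof.
move=> hA fC dC dm [fR dR].
apply: (@eliminable_ext (fun F e V => C F e /\ vle (m F e) V -> R F e V));
  last first.
  by move=> F e V; rewrite hA.
split=> [|M K dM uK].
  apply: (fresh_factor (fresh_pair fC (fresh_pair (proj1 dm) fR))).
  by move=> F e e' [-> -> ->].
have dMm := definable_valU dM dm.
apply: definable_ext (definable_imp dC (dR _ _ dMm uK)) _ => F e; split.
  move=> h V MV.
  have [[hC mV]|] := pselect (C F e /\ vle (m F e) V); last by tauto.
  have [|RV|] := h hC V; [|by left|by right].
  by move=> p t [/MV|/mV].
move=> h hC V MmV; have [p t Mt|RV|] := h V; last by right.
  by apply: MmV; left.
by left; apply: RV; split=> // p t mt; apply: MmV; right.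
Qed.

Lemma eliminable_guard C R : fresh C -> definable C ->
  eliminable R -> eliminable (fun F e V => C F e -> R F e V).
Proof.
move=> fC dC; apply: eliminable_imp_lower fC dC definable_val0.
by move=> F e V; split=> [hC|[]//]; split.
Qed.

Lemma eliminable_and R R' : eliminable R -> eliminable R' ->
  eliminable (fun F e V => R F e V /\ R' F e V).
Proof.
move=> [fR dR] [fR' dR']; split=> [|M K dM uK].
  by apply: (fresh_factor (fresh_pair fR fR')) => F e e' [-> ->].
apply: definable_ext (definable_and (dR M K dM uK) (dR' M K dM uK)) _ => F e.
split=> [[h h'] V MV|h]; first by have := (h V MV, h' V MV); tauto.
by split=> V MV; have := h V MV; tauto.
Qed.

(** A first-order quantifier commutes with the quantifier over valuations, and
    with the disjunction with [K], which does not depend on [t]. *)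
Lemma eliminable_allW (R : forall F, env F -> F -> (PV -> set F) -> Prop) :
  fresh R -> (forall z, eliminable (fun F e => R F e (e.1 z))) ->
  eliminable (fun F e V => forall t, R F e t V).
Proof.
move=> fR eR; split=> [|M K dM uK].
  by apply: (fresh_factor fR) => F e e' ->.
have [fK _ _] := uK.
apply: (@definable_ext (fun F e => forall t V, vle (M F e) V ->
  R F e t V \/ K F e V)).
  apply: definable_allW => [|z]; last exact: (proj2 (eR z)).
  apply: (fresh_factor (fresh_pair fR (fresh_pair (proj1 dM) fK))).
  by move=> F e e' [-> -> ->].
move=> F e; split=> [h V MV|h t V /h[/(_ t)|]]; [|by left|by right].
have [|nK] := pselect (K F e V); [by right|left=> t].
by have [] := h t V MV.
Qed.

Lemma eliminable_allS (R : forall F, env F -> set F -> (PV -> set F) -> Prop) :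
  fresh R -> (forall Z, eliminable (fun F e => R F e (e.2 Z))) ->
  eliminable (fun F e V => forall T, R F e T V).
Proof.
move=> fR eR; split=> [|M K dM uK].
  by apply: (fresh_factor fR) => F e e' ->.
have [fK _ _] := uK.
apply: (@definable_ext (fun F e => forall t V, vle (M F e) V ->
  R F e t V \/ K F e V)).
  apply: definable_allS => [|z]; last exact: (proj2 (eR z)).
  apply: (fresh_factor (fresh_pair fR (fresh_pair (proj1 dM) fK))).
  by move=> F e e' [-> -> ->].
move=> F e; split=> [h V MV|h t V /h[/(_ t)|]]; [|by left|by right].
have [|nK] := pselect (K F e V); [by right|left=> t].
by have [] := h t V MV.
Qed.

(** * Sahlqvist antecedents *)

Definition absorbable a : Prop := forall x R, eliminable R ->
  eliminable (fun F e V => sat V (e.1 x) a -> R F e V).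

(** The form in which the last argument of a modality is met, at a witnessing
    neighbourhood [X]. *)
Definition absorbable_in a : Prop := forall X R, eliminable R ->
  eliminable (fun F e V => (forall s, e.2 X s -> sat V s a) -> R F e V).

Lemma absorbable_pseudo_boxed (z : form PV) : pseudo_boxed z -> absorbable z.
Proof.
move=> /pseudo_boxed_lower[C [m [hz dC dm]]] x R.
apply: (eliminable_imp_lower (C := fun F e => C F (e.1 x))
                             (m := fun F e => m F (e.1 x))) => //.
  by apply: (fresh_factor (fresh_varW x)) => F e e' ->.
by split=> //; apply: (fresh_factor (fresh_varW x)) => F e e' ->.
Qed.

Lemma absorbable_in_pseudo_boxed (z : form PV) :
  pseudo_boxed z -> absorbable_in z.
Proof.
move=> /pseudo_boxed_lower[C [m [hz dC dm]]] X R.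
apply: (eliminable_imp_lower (C := fun F e => forall s, e.2 X s -> C F s)
  (m := fun F e p t => exists2 s, e.2 X s & m F s p t)).
- move=> F e V; split=> [h|[hC hm] s Xs].
    split=> [s /h /hz[]//|p t [s /h /hz[_]]]; exact.
  by apply/hz; split; [apply: hC | move=> p t mt; apply: hm; exists s].
- by apply: (fresh_factor (fresh_varS X)) => F e e' ->.
- by apply: definable_allin => //; apply: fresh_const.
- split=> [|p y].
    by apply: (fresh_factor (fresh_varS X)) => F e e' ->.
  apply: definable_exin => [|s]; last exact: dm.
  by apply: (fresh_factor (fresh_varW y)) => F e e' ->.
Qed.

Lemma absorbable_negative (c : form PV) : negative c -> absorbable c.
Proof.
move=> neg x R; apply: eliminable_imp_downward.
apply: (upward_positive (a := Neg c)) => p k [j -> /neg /=].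
by rewrite negbK.
Qed.

Lemma absorbable_in_negative (c : form PV) : negative c -> absorbable_in c.
Proof.
move=> neg X R; apply: eliminable_imp_downward; split.
- by apply: (fresh_factor (fresh_varS X)) => F e e' ->.
- move=> F e V V' VV' h h'; apply: h => s /h'; exact: sat_negative.
- move=> M dM; apply: definable_not; apply: definable_allin => [|z].
    by apply: (fresh_factor (proj1 dM)) => F e e' ->.
  exact: definable_sat.
Qed.

(** The witness moves to the front as a universally quantified world. *)
Lemma eliminable_imp_exin a X R : absorbable a -> eliminable R ->
  eliminable (fun F e V => (exists2 s, e.2 X s & sat V s a) -> R F e V).
Proof.
move=> ha eR.
apply: (@eliminable_ext (fun F e V =>
    forall s, e.2 X s -> sat V s a -> R F e V)).
  apply: (eliminable_allW (R := fun F e s V => e.2 X s -> sat V s a -> R F e V))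
    => [|z].
    apply: (fresh_factor (fresh_pair (fresh_varS X) (proj1 eR))).
    by move=> F e e' [-> ->].
  apply: eliminable_guard (definable_mem X z) _; last exact: ha.
  apply: (fresh_factor (fresh_pair (fresh_varS X) (fresh_varW z))).
  by move=> F e e' [-> ->].
move=> F e V; split=> [h [s]|h s Xs sa]; first exact: h.
by apply: h; exists s.
Qed.

(** The neighbourhood and the witnesses of the first arguments, which the
    antecedent quantifies existentially, become universal quantifiers in front;
    nested implications remain, and are absorbed one after the other. *)
Lemma absorbable_box n (f : 'I_n -> form PV) a :
  (forall i, absorbable (f i)) -> absorbable_in a -> absorbable (Box n f a).
Proof.
move=> hf ha x R eR.
(* Lists of indices allow an induction that treats the arguments one by one. *)
have ef X (s : seq 'I_n) : eliminable (fun F e V =>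
    (forall i, i \in s -> exists2 t, e.2 X t & sat V t (f i)) -> R F e V).
  elim: s => [|j s IHs].
    by apply: eliminable_ext eR _ => F e V; split=> // h; apply: h.
  apply: eliminable_ext (eliminable_imp_exin X (hf j) IHs) _ => F e V; split.
    move=> h hs; apply: h => [|i si]; first by apply: hs; rewrite mem_head.
    by apply: hs; rewrite inE si orbT.
  by move=> h hj hs; apply: h => i; rewrite inE => /orP[/eqP->|/hs].
apply: (@eliminable_ext (fun F e V => forall S, nbhd (e.1 x) S ->
    (forall s, S s -> sat V s a) ->
    (forall i, i \in enum 'I_n -> exists2 s, S s & sat V s (f i)) -> R F e V)).
  apply: (eliminable_allS (R := fun F e S V => nbhd (e.1 x) S ->
    (forall s, S s -> sat V s a) ->
    (forall i, i \in enum 'I_n -> exists2 s, S s & sat V s (f i)) -> R F e V))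
    => [|Z].
    apply: (fresh_factor (fresh_pair (fresh_varW x) (proj1 eR))).
    by move=> F e e' [-> ->].
  apply: eliminable_guard (definable_nbhd x Z) _; last exact: ha.
  apply: (fresh_factor (fresh_pair (fresh_varW x) (fresh_varS Z))).
  by move=> F e e' [-> ->].
move=> F e V; split=> [h [S [xS aS fS]]|h S xS aS fS].
  by apply: (h S).
by apply: h; exists S; split=> // i; apply: fS; rewrite mem_enum.
Qed.

Lemma absorbable_sahlqvist a : sahlqvist_antecedent a -> absorbable a.
Proof.
elim=> {a} [z|c|||a b _ IHa _ IHb|a b _ IHa _ IHb|n th f pth _ IHf
           |n f z _ IHf hz|n f c _ IHf hc].
- exact: absorbable_pseudo_boxed.
- exact: absorbable_negative.
- exact/absorbable_pseudo_boxed/pb_bot.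
- exact/absorbable_pseudo_boxed/pb_top.
- move=> x R eR; apply: eliminable_ext (IHa x _ (IHb x _ eR)) _ => F e V /=.
  tauto.
- move=> x R eR.
  apply: eliminable_ext (eliminable_and (IHa x _ eR) (IHb x _ eR)) _.
  move=> F e V /=.
  tauto.
- exact/(absorbable_box IHf)/absorbable_in_negative/pure_negative.
- exact/(absorbable_box IHf)/absorbable_in_pseudo_boxed.
- exact/(absorbable_box IHf)/absorbable_in_negative.
Qed.

Lemma definable_valid_imp (phi psi : form PV) x :
  sahlqvist_antecedent phi -> positive psi ->
  definable (fun F e => valid_at (e.1 x) (Imp phi psi)).
Proof.
move=> hphi hpsi.
have [_ elim] := absorbable_sahlqvist hphi x eliminable_false.
apply: definable_ext (elim _ _ definable_val0 (upward_positive x hpsi)) _.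
by move=> F e; split=> [h V|h V _]; [apply: (h V) => p t [] | apply: h].
Qed.

End Sahlqvist.

(** * Universal closure *)

(** If the truth value of a formula depends on the value of [x] alone, then
    quantifying its other free variables universally changes nothing, as the
    domains of both sorts are nonempty. *)
Lemma definable_by_one_variable (Q : forall F : nframe, F -> Prop) x :
  definable (fun F e => Q F (e.1 x)) ->
  exists a, [/\ pred_free a, {subset fvW a <= [:: x]}, fvS a = [::] &
    forall (F : nframe) (I : nat -> set F) (g : nat -> F) (G : nat -> set F),
      L1_sat (M := frame2 I) g G a <-> Q F (g x)].
Proof.
move=> [a pa ha].
pose allW s b := foldr LAllW b s; pose allS s b := foldr LAllS b s.
have pW s b : pred_free (allW s b) = pred_free b by elim: s.
have pS s b : pred_free (allS s b) = pred_free b by elim: s.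
have fvWW s b : fvW (allW s b) = [seq y <- fvW b | y \notin s].
  elim: s => [|z s IHs] /=; first by rewrite filter_predT.
  rewrite IHs -filter_predI; apply: eq_filter => y /=.
  by rewrite inE negb_or.
have fvSS s b : fvS (allS s b) = [seq y <- fvS b | y \notin s].
  elim: s => [|z s IHs] /=; first by rewrite filter_predT.
  rewrite IHs -filter_predI; apply: eq_filter => y /=.
  by rewrite inE negb_or.
have fvWS s b : fvW (allS s b) = fvW b by elim: s.
pose defines b := forall (F : nframe) I (g : nat -> F) (G : nat -> set F),
  L1_sat (M := frame2 I) g G b <-> Q F (g x).
have defW s b : x \notin s -> defines b -> defines (allW s b).
  move=> + hb; elim: s => [//|z s IHs].
  rewrite inE negb_or => /andP[xz /IHs {}IHs] F I g G /=.
  have IH t : L1_sat (M := frame2 I) (upd g z t) G (allW s b) <-> Q F (g x).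
    by apply: (iff_trans (IHs _ _ _ _)); rewrite /upd (negbTE xz).
  by split=> [/(_ (g x)) /IH|h t]; [|apply/IH].
have defS s b : defines b -> defines (allS s b).
  move=> hb; elim: s => [//|Z s IHs] F I g G /=.
  by split=> [/(_ (G Z)) /IHs|h T]; [|apply/IHs].
pose b := allW [seq y <- fvW a | y != x] a.
exists (allS (fvS b) b); split.
- by rewrite pS pW.
- move=> y; rewrite fvWS fvWW mem_filter mem_filter inE => /andP[+ ya].
  by rewrite ya andbT negbK.
- rewrite fvSS; apply/eqP; rewrite -(negbK (_ == _)) -has_filter.
  by apply/hasPn => y; rewrite negbK.
- apply/defS/defW; first by rewrite mem_filter eqxx.
  by move=> F I g G; apply: (ha F I (g, G)).
Qed.

Theorem theorem4p3 (PV : Type) (phi psi : form PV) (x : nat)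
  (hphi : sahlqvist_antecedent phi) (hpsi : positive psi) :
  exists alpha : L1,
    [/\ pred_free alpha,
        {subset fvW alpha <= [:: x]},
        fvS alpha = [::] &
        forall (F : nframe) (w : F)
          (I : nat -> set F) (g : nat -> F) (G : nat -> set F),
          valid_at w (Imp phi psi) <->
          L1_sat (M := frame2 I) (upd g x w) G alpha].
Proof.
have [a [pa fa fSa ha]] :=
  definable_by_one_variable (Q := fun F w => valid_at w (Imp phi psi))
    (definable_valid_imp x hphi hpsi).
exists a; split=> // F w I g G.
by apply: iff_sym; apply: (iff_trans (ha F I _ G)); rewrite /upd eqxx.
Qed.
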